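(* Let $(x_k)_{k\ge0}$ and $(y_k)_{k\ge0}$ be produced by Algorithm (C) (see context) and let $v_k$ be the minimizer of the associated surrogate $d_k$, with $v_0=y_0=x_0$. Then, for all $k\ge1$, $$\mathbb E\left[F(x_k)-F^\star+\frac{\gamma_k}2\|v_k-x^\star\|^2\right]\le\Gamma_k\left(F(x_0)-F^\star+\frac{\gamma_0}2\|x_0-x^\star\|^2+\sum_{t=1}^k\frac{\eta_t\omega_t^2}{\Gamma_t}\right),$$ where $\Gamma_t=\prod_{i=1}^t(1-\delta_i)$ and $\omega_t^2=\mathbb E[\|\nabla f(y_{t-1})-g_t\|^2]$.
   Context: Problem: minimize $F=f+\psi$ on $\mathbb R^p$; $f$ is convex, $L$-smooth (differentiable with $L$-Lipschitz gradient) and $\mu$-strongly convex with $\mu\ge0$ ($\mu=0$ meaning merely convex); $\psi:\mathbb R^p\to\mathbb R\cup\{+\infty\}$ is proper convex lower semicontinuous; $x^\star$ is a minimizer of $F$, $F^\star=F(x^\star)$. $\mathrm{Prox}_{\eta\psi}[u]=\arg\min_x\{\eta\psi(x)+\frac12\|x-u\|^2\}$. Algorithm (C): deterministic step sizes $0<\eta_k\le1/L$ ($k\ge0$), parameter $\gamma_0\ge\mu$, $\gamma_0>0$; sequences with $\delta_k=\sqrt{\eta_k\gamma_k}$ for all $k\ge0$ and $\gamma_k=(1-\delta_k)\gamma_{k-1}+\delta_k\mu$ for all $k\ge1$. Start from $y_0=x_0$ and for $k\ge1$ set $x_k=\mathrm{Prox}_{\eta_k\psi}[y_{k-1}-\eta_kg_k]$,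 where $\mathbb E[g_k\mid\mathcal F_{k-1}]=\nabla f(y_{k-1})$, $y_k=x_k+\beta_k(x_k-x_{k-1})$ with $\beta_k=\frac{\delta_k(1-\delta_k)\eta_{k+1}}{\eta_k\delta_{k+1}+\eta_{k+1}\delta_k^2}$. $\mathcal F_{k-1}$ is the filtration representing all information up to iteration $k-1$. Surrogates: $d_0(x)=d_0^\star+\frac{\gamma_0}2\|x-x_0\|^2$ ($d_0^\star$ an arbitrary real) and $d_k=(1-\delta_k)d_{k-1}+\delta_kl_k$ for $k\ge1$, with $l_k(x)=f(y_{k-1})+g_k^\top(x-y_{k-1})+\frac\mu2\|x-y_{k-1}\|^2+\psi(x_k)+\psi'(x_k)^\top(x-x_k)$ and $\psi'(x_k)=\frac1{\eta_k}(y_{k-1}-x_k)-g_k\in\partial\psi(x_k)$. Thus $d_k(x)=d_k^\star+\frac{\gamma_k}2\|x-v_k\|^2$. Convention: $\Gamma_k/\Gamma_t=\prod_{i=t+1}^k(1-\delta_i)$ (relevant only if some $\delta_i=1$). *)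

(* Defs.v *)
From HB Require Import structures.
From mathcomp Require Export all_boot all_order all_algebra.
From mathcomp Require Export all_classical all_reals all_analysis.
Export Order.TTheory GRing.Theory Num.Theory.
Export numFieldNormedType.Exports.

Set Implicit Arguments.
Unset Strict Implicit.
Unset Printing Implicit Defensive.

Local Open Scope classical_set_scope.
Local Open Scope ring_scope.

Definition argmin (X : Type) (disp : Order.disp_t) (O : porderType disp)
    (h : X -> O) : set X :=
  [set x | forall z, (h x <= h z)%O].

Section euclidean.
Context {R : realType} {p : nat}.
Implicit Types u v x : 'rV[R]_p.

Definition dotv u v : R := \sum_(i < p) u 0 i * v 0 i.

(* The library norm on 'rV[R]_p is the sup norm; it induces the same topology
   and the same notion of differentiability as norm2. *)
Definition norm2 u : R := Num.sqrt (dotv u u).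

Definition grad (f : 'rV[R]_p -> R) x : 'rV[R]_p :=
  \row_(i < p) 'D_(delta_mx 0 i) f x.

Definition smooth (L : R) (f : 'rV[R]_p -> R) : Prop :=
  (forall x, differentiable f x) /\
  (forall x z, norm2 (grad f x - grad f z) <= L * norm2 (x - z)).

Definition strongly_convex (mu : R) (f : 'rV[R]_p -> R) : Prop :=
  forall x z (t : R), 0 <= t <= 1 ->
    f (t *: x + (1 - t) *: z) <=
    t * f x + (1 - t) * f z - mu / 2 * t * (1 - t) * norm2 (x - z) ^+ 2.

Definition proper (psi : 'rV[R]_p -> \bar R) : Prop :=
  (forall x, psi x != -oo%E) /\ (exists x, psi x != +oo%E).

(* The endpoints t = 0, 1 are harmless: 0 * +oo = 0 in \bar R. *)
Definition convexe (psi : 'rV[R]_p -> \bar R) : Prop :=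
  forall x z (t : R), 0 <= t <= 1 ->
    (psi (t *: x + (1 - t) *: z)%R <= t%:E * psi x + (1 - t)%:E * psi z)%E.

(* For psi proper, convex and lower semicontinuous this set is the singleton
   consisting of the proximal point of u. *)
Definition prox (eta : R) (psi : 'rV[R]_p -> \bar R) u : set 'rV[R]_p :=
  argmin (fun z => (eta%:E * psi z + (2^-1 * norm2 (z - u) ^+ 2)%:E)%E).

Definition objective (f : 'rV[R]_p -> R) (psi : 'rV[R]_p -> \bar R) x : \bar R :=
  ((f x)%:E + psi x)%E.

End euclidean.

Section conditional_expectation.
Context {d : measure_display} {T : measurableType d} {R : realType}.

(* Measurability with respect to the sigma-algebra generated by G, which is G
   itself when G is a sigma-algebra. *)
Definition sub_measurable (G : set (set T)) (X : T -> R) : Prop :=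
  measurable_fun [set: g_sigma_algebraType G] (X : g_sigma_algebraType G -> R).

Definition filtration (G : nat -> set (set T)) : Prop :=
  [/\ forall k, sigma_algebra [set: T] (G k),
      forall k, G k `<=` measurable
    & forall k, G k `<=` G k.+1].

(* Y is a version of E[X | G]. *)
Definition is_cond_exp (P : probability T R) (G : set (set T)) (X Y : T -> R)
    : Prop :=
  [/\ P.-integrable [set: T] (EFin \o X),
      P.-integrable [set: T] (EFin \o Y),
      sub_measurable G Y
    & forall A, G A ->
        (\int[P]_(w in A) (X w)%:E = \int[P]_(w in A) (Y w)%:E)%E].

End conditional_expectation.

Section accelerated_method.
Context {R : realType} {p : nat}.
Variables (f : 'rV[R]_p -> R) (psi : 'rV[R]_p -> \bar R).
Variables (mu : R) (eta delta : nat -> R).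

Definition extrapolation (k : nat) : R :=
  delta k * (1 - delta k) * eta k.+1 /
  (eta k * delta k.+1 + eta k.+1 * delta k ^+ 2).

(* prod_ratio t k stands for Gamma_k / Gamma_t; it is meaningful even when some
   factor 1 - delta i vanishes. *)
Definition prod_ratio (t k : nat) : R := \prod_(t.+1 <= i < k.+1) (1 - delta i).

Definition Gamma (k : nat) : R := \prod_(1 <= i < k.+1) (1 - delta i).

(* Below, g, x, y are the sequences along one trajectory. *)

Definition psi_subgrad (g x y : nat -> 'rV[R]_p) (k : nat) : 'rV[R]_p :=
  (eta k)^-1 *: (y k.-1 - x k) - g k.

(* Meaningful for k >= 1; psi (x k) is finite because x k is a proximal point. *)
Definition lower_model (g x y : nat -> 'rV[R]_p) (k : nat) (z : 'rV[R]_p) : R :=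
  f (y k.-1) + dotv (g k) (z - y k.-1) + mu / 2 * norm2 (z - y k.-1) ^+ 2
  + fine (psi (x k)) + dotv (psi_subgrad g x y k) (z - x k).

Fixpoint surrogate (d0 gamma0 : R) (g x y : nat -> 'rV[R]_p) (k : nat)
    (z : 'rV[R]_p) : R :=
  if k is k'.+1 then
    (1 - delta k) * surrogate d0 gamma0 g x y k' z
    + delta k * lower_model g x y k z
  else d0 + gamma0 / 2 * norm2 (z - x 0%N) ^+ 2.

End accelerated_method.

(* Main.v *)
(* For one trajectory, put n = g_k - grad f (y_{k-1}) and let V_k be the energy
   F (x_k) - F (xstar) + gamma_k / 2 |v_k - xstar|^2. The extrapolation makes
   y_{k-1} the combination of x_{k-1} and v_{k-1} that cancels the terms linear
   in the composite gradient step, and comparing x_k with the noiseless proximal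
   point w = Prox (y_{k-1} - eta_k grad f (y_{k-1})) gives
     V_k <= (1 - delta_k) V_{k-1} + eta_k |n|^2 + <n, Z>,
   where Z = (1 - delta_k) x_{k-1} + delta_k xstar - w is F_{k-1}-measurable.
   No integrability of Z is available, so the last term is removed by summing
   over the level sets of a discretization of Z, on each of which Z is almost
   constant and n has integral 0. *)
Require Import Defs.
From mathcomp Require Import ring lra.
Import measurable_realfun.

Set Implicit Arguments.
Unset Strict Implicit.
Unset Printing Implicit Defensive.

Local Open Scope classical_set_scope.
Local Open Scope ring_scope.

(** * Euclidean inner product and norm on row vectors *)

Section dot_product.
Context {R : realType} {p : nat}.
Implicit Types (u v w x z : 'rV[R]_p) (c : R).

Lemma dotvC u v : dotv u v = dotv v u.
Proof. by apply: eq_bigr => i _; rewrite mulrC. Qed.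

Lemma dotvDl u v w : dotv (u + v) w = dotv u w + dotv v w.
Proof. by rewrite -big_split; apply: eq_bigr => i _; rewrite mxE mulrDl. Qed.

Lemma dotvZl c u v : dotv (c *: u) v = c * dotv u v.
Proof. by rewrite mulr_sumr; apply: eq_bigr => i _; rewrite mxE mulrA. Qed.

Lemma dotvNl u v : dotv (- u) v = - dotv u v.
Proof. by rewrite -scaleN1r dotvZl mulN1r. Qed.

Lemma dotvDr u v w : dotv w (u + v) = dotv w u + dotv w v.
Proof. by rewrite !(dotvC w) dotvDl. Qed.

Lemma dotvZr c u v : dotv v (c *: u) = c * dotv v u.
Proof. by rewrite !(dotvC v) dotvZl. Qed.

Lemma dotvNr u v : dotv v (- u) = - dotv v u.
Proof. by rewrite !(dotvC v) dotvNl. Qed.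

Lemma dotv0l u : dotv 0 u = 0.
Proof. by rewrite -(scale0r 0) dotvZl mul0r. Qed.

Definition dotvE := (dotvDl, dotvDr, dotvZl, dotvZr, dotvNl, dotvNr).

Lemma dotv_ge0 u : 0 <= dotv u u.
Proof. by apply: sumr_ge0 => i _; rewrite -expr2 sqr_ge0. Qed.

Lemma norm2_sqr u : norm2 u ^+ 2 = dotv u u.
Proof. by rewrite /norm2 sqr_sqrtr // dotv_ge0. Qed.

Lemma norm2_ge0 u : 0 <= norm2 u.
Proof. exact: sqrtr_ge0. Qed.

Lemma dotv_eq0 u : dotv u u = 0 -> u = 0.
Proof.
move/eqP; rewrite psumr_eq0 => [/allP u0|i _]; last by rewrite -expr2 sqr_ge0.
apply/rowP => i; rewrite mxE; apply/eqP.
by have := u0 i (mem_index_enum i); rewrite mulf_eq0 orbb.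
Qed.

Lemma norm2_eq0 u : norm2 u = 0 -> u = 0.
Proof. by move=> u0; apply: dotv_eq0; rewrite -norm2_sqr u0 expr0n. Qed.

(** Cauchy-Schwarz: expand the square of [norm2 v *: u - norm2 u *: v] and divide by
    [norm2 u * norm2 v]. *)
Lemma dotv_le_norm2 u v : dotv u v <= norm2 u * norm2 v.
Proof.
have [u0|u_neq0] := eqVneq (norm2 u) 0.
  by rewrite u0 mul0r (norm2_eq0 u0) dotv0l.
have [v0|v_neq0] := eqVneq (norm2 v) 0.
  by rewrite v0 mulr0 (norm2_eq0 v0) dotvC dotv0l.
have uv_gt0 : 0 < norm2 u * norm2 v by rewrite mulr_gt0 ?lt0r ?norm2_ge0 ?andbT.
have := dotv_ge0 (norm2 v *: u - norm2 u *: v).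
rewrite !dotvE (dotvC v u) -!norm2_sqr => le_uv.
rewrite -(ler_pM2l uv_gt0); nra.
Qed.

(** Lets Euclidean estimates control the sup-norm balls that define the topology. *)
Lemma coord_le_norm2 u i : `|u 0 i| <= norm2 u.
Proof.
rewrite -ler_sqr ?nnegrE ?normr_ge0 ?norm2_ge0 // norm2_sqr real_normK ?num_real //.
rewrite /dotv (bigD1 i) //= -expr2 lerDl.
by apply: sumr_ge0 => j _; rewrite -expr2 sqr_ge0.
Qed.

Lemma norm2_sqr_continuous z : continuous (fun u => norm2 (u - z) ^+ 2).
Proof.
have -> : (fun u => norm2 (u - z) ^+ 2) = (fun u => dotv (u - z) (u - z)).
  by apply/funext => u; rewrite norm2_sqr.
move=> u.
apply: (@cvg_big _ _ +%R _ _ add_continuous _ (nbhs u)) => i _.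
have h : (fun x : 'rV[R]_p => (x - z) 0 i) @ u --> (u - z) 0 i.
  rewrite !mxE; under eq_fun do rewrite !mxE.
  by apply: (@cvgB _ _ _ (nbhs u)); [exact: coord_continuous|exact: cvg_cst].
exact: (@cvgM _ _ (nbhs u) _ _ _ _ _ h h).
Qed.

End dot_product.

(** * Quadratic bounds for smooth and strongly convex functions *)

Section smooth_convex.
Context {R : realType} {p : nat}.
Variables (f : 'rV[R]_p -> R) (L mu : R).
Implicit Types (x y z h : 'rV[R]_p).

Lemma derive_dotv_grad x h : differentiable f x ->
  'D_h f x = dotv (grad f x) h.
Proof.
move=> df; rewrite deriveE // {1}(row_sum_delta h) linear_sum.
by apply: eq_bigr => i _; rewrite linearZ /= mxE deriveE // mulrC.
Qed.

Lemma is_derive_line x h (t : R) : differentiable f (x + t *: h) ->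
  is_derive t 1 (fun s : R => f (x + s *: h)) (dotv (grad f (x + t *: h)) h).
Proof.
move=> df; rewrite -derive_dotv_grad //.
have qE : (fun s : R => s^-1 *: (((fun s => f (x + s *: h)) \o shift t) (s *: 1)
                                 - f (x + t *: h)))
        = (fun s => s^-1 *: ((f \o shift (x + t *: h)) (s *: h)
                             - f (x + t *: h))).
  apply/funext => s /=; congr (_ *: (f _ - _)).
  by rewrite [s *: 1]mulr1 scalerDl addrCA.
split; last by rewrite /derive qE.
have : derivable f (x + t *: h) h by exact: diff_derivable.
by rewrite /derivable qE.
Qed.

(** Descent lemma: up to a constant, [phi] is [f] minus the claimed bound along the segment. Its
    derivative [dphi] is nonpositive for [t > 0] by Cauchy-Schwarz and the Lipschitz gradient. *)
Lemma smooth_upper_bound x z : 0 <= L -> smooth L f ->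
  f z <= f x + dotv (grad f x) (z - x) + L / 2 * norm2 (z - x) ^+ 2.
Proof.
move=> L_ge0 [df gradL]; move hE : (z - x) => h.
pose phi := fun t : R => f (x + t *: h) - t * dotv (grad f x) h
                         - L / 2 * t ^+ 2 * norm2 h ^+ 2.
pose dphi := fun t : R => dotv (grad f (x + t *: h)) h - dotv (grad f x) h
                         - L * t * norm2 h ^+ 2.
have dphiE (t : R) : is_derive t (1 : R) phi (dphi t).
  have := is_derive_line (df (x + t *: h)) => ?.
  apply: is_derive_eq.
  rewrite /dphi /= /GRing.scale /= !mulr0 ?mul0r ?add0r ?addr0 ?mulr1 ?scaler0.
  by field.
have : phi 1 <= phi 0.
  apply: (@ler0_derive1_nincr _ phi 0 1) => //.
  - move=> t; rewrite in_itv /= => /andP[t_gt0 _].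
    rewrite derive1E derive_val /dphi.
    have := dotv_le_norm2 (grad f (x + t *: h) - grad f x) h.
    rewrite !dotvE => /le_trans/(_ (ler_wpM2r (norm2_ge0 h) (gradL _ _))).
    rewrite (addrC x) addrK.
    have -> : norm2 (t *: h) = t * norm2 h.
      by rewrite /norm2 !dotvE mulrA sqrtrM ?mulr_ge0 ?ltW // -expr2 sqrtr_sqr gtr0_norm.
    by rewrite -subr_le0; apply: le_trans; rewrite le_eqVlt; apply/orP; left; apply/eqP; ring.
  - by apply: derivable_within_continuous => t _.
rewrite /phi scale1r scale0r addr0 -hE (addrC x) subrK; lra.
Qed.

(** Divide the strong convexity inequality at [s *: z + (1 - s) *: x] by [s] and let [s] decrease to
    0. *)
Lemma strongly_convex_lower_bound x z : differentiable f x ->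
  strongly_convex mu f ->
  f x + dotv (grad f x) (z - x) + mu / 2 * norm2 (z - x) ^+ 2 <= f z.
Proof.
move=> df cvxf; move hE : (z - x) => h.
have df0 : differentiable f (x + 0 *: h) by rewrite scale0r addr0.
have := is_derive_line df0; rewrite scale0r addr0.
set phi := fun s : R => f (x + s *: h) => -[dphi dphiE].
have quot : (s^-1 * (phi s - phi 0)) @[s --> 0^'+] --> dotv (grad f x) h.
  rewrite -dphiE; apply: cvg_dnbhs_at_right.
  suff -> : (fun s => s^-1 * (phi s - phi 0)) =
            (fun s => s^-1 *: ((phi \o shift 0) (s *: 1) - phi 0)) by exact: dphi.
  by apply/funext => s /=; rewrite addr0 [s *: 1]mulr1.
have bound : (f z - f x - mu / 2 * (1 - s) * norm2 h ^+ 2) @[s --> 0^'+] -->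
    f z - f x - mu / 2 * (1 - 0) * norm2 h ^+ 2.
  apply: cvgB; first exact: cvg_cst.
  apply: cvgMr_tmp; apply: cvgMl_tmp; apply: cvgB; first exact: cvg_cst.
  exact/cvg_at_right_filter/cvg_id.
suff : dotv (grad f x) h <= f z - f x - mu / 2 * (1 - 0) * norm2 h ^+ 2 by lra.
apply: ler_cvg_to quot bound _.
near=> s.
have s_gt0 : 0 < s by near: s; exact: nbhs_right_gt.
have s_le1 : s <= 1 by near: s; exact: nbhs_right_le.
have s01 : 0 <= s <= 1 by rewrite ltW.
have := cvxf z x s s01.
have -> : s *: z + (1 - s) *: x = x + s *: h.
  by rewrite -hE; apply/rowP => i; rewrite !mxE; ring.
rewrite hE (mulrC s^-1) ler_pdivrMr // /phi scale0r addr0; lra.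
Unshelve. all: by end_near.
Qed.

(** The lower quadratic bound at 0 lies below the upper one; evaluating both at a unit vector
    compares [mu] with [L]. *)
Lemma strong_convexity_le_smoothness : (0 < p)%N -> 0 <= L -> smooth L f ->
  strongly_convex mu f -> mu <= L.
Proof.
move=> p_gt0 L_ge0 sf cf; pose e : 'rV[R]_p := delta_mx 0 (Ordinal p_gt0).
have := smooth_upper_bound 0 e L_ge0 sf.
move/(le_trans (strongly_convex_lower_bound e (sf.1 0) cf)).
have e1 : norm2 (e - 0) ^+ 2 = 1.
  rewrite subr0 norm2_sqr /dotv (bigD1 (Ordinal p_gt0)) //= big1 => [|i ne].
    by rewrite !mxE !eqxx mulr1 addr0.
  by rewrite !mxE (negbTE ne) mulr0.
by rewrite e1; lra.
Qed.

End smooth_convex.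

(** * The proximal operator: optimality condition, nonexpansiveness, existence, continuity *)

Section proximal_operator.
Context {R : realType} {p : nat}.
Variables (psi : 'rV[R]_p -> \bar R) (eta : R).
Hypotheses (eta_gt0 : 0 < eta) (psi_proper : proper psi).
Implicit Types (u x z : 'rV[R]_p).

Lemma prox_fin_num u x : prox eta psi u x -> psi x \is a fin_num.
Proof.
move=> min_x; have [z z_fin] := psi_proper.2.
rewrite fin_numE psi_proper.1 /=; apply/eqP => xy.
have := min_x z; rewrite xy gt0_muley ?lte_fin // addye // leye_eq.
move: z_fin (psi_proper.1 z); by case: (psi z).
Qed.

Hypothesis psi_convex : convexe psi.

(** Minimality of [x] against [t *: z + (1 - t) *: x], with convexity of [psi], gives
    [0 <= A + t / 2 * B]. For small [t] only [0 <= A] remains, which is the claim multiplied by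
    [eta]. *)
Lemma prox_subgradient u x z : prox eta psi u x ->
  ((fine (psi x) + dotv (eta^-1 *: (u - x)) (z - x))%:E <= psi z)%E.
Proof.
move=> min_x; have := fineK (prox_fin_num min_x).
move: (fine _) => r0 r0E.
have := psi_proper.1 z; case zE : (psi z) => [r| |] // _; last by rewrite leey.
rewrite lee_fin dotvZl.
set A := eta * (r - r0) + dotv (x - u) (z - x).
set B := norm2 (z - x) ^+ 2.
have B_ge0 : 0 <= B by rewrite sqr_ge0.
have AB t : 0 < t <= 1 -> 0 <= A + t / 2 * B.
  move=> /andP[t_gt0 t_le1].
  have t01 : 0 <= t <= 1 by rewrite (ltW t_gt0).
  have := psi_convex z x t01; rewrite zE -r0E -!EFinM -EFinD.
  have := min_x (t *: z + (1 - t) *: x).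
  have := psi_proper.1 (t *: z + (1 - t) *: x).
  case: (psi _) => [s| |] // _; rewrite -r0E -!EFinM -!EFinD !lee_fin.
  have -> : t *: z + (1 - t) *: x - u = (x - u) + t *: (z - x).
    by apply/rowP => i; rewrite !mxE; ring.
  rewrite !norm2_sqr /A /B norm2_sqr.
  move: (z - x) (x - u) => h k; rewrite !dotvE (dotvC h k) => le1 le2.
  rewrite -(pmulr_rge0 _ t_gt0).
  by have := ler_wpM2l (ltW eta_gt0) le2; lra.
suff A_ge0 : 0 <= A.
  rewrite -lerBrDl mulrC ler_pdivrMr // -(opprB x u) dotvNl.
  by move: A_ge0; rewrite /A; lra.
rewrite leNgt; apply/negP => A_lt0.
have B1_gt0 : 0 < B + 1 by lra.
(* For negative [A], the value [t = - A / (B + 1)], or 1 if that is smaller, already makes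
   [A + t / 2 * B] negative. *)
have [le1|gt1] := leP (- A / (B + 1)) 1.
  have t_gt0 : 0 < - A / (B + 1) by rewrite divr_gt0 // oppr_gt0.
  have := AB (- A / (B + 1)); rewrite t_gt0 le1 => /(_ isT).
  have -> : - A / (B + 1) / 2 * B = - A / 2 * (1 - (B + 1)^-1).
    by field; rewrite gt_eqF.
  have : 0 < (B + 1)^-1 by rewrite invr_gt0.
  nra.
have := AB 1; rewrite ltr01 lexx => /(_ isT).
by move: gt1; rewrite ltr_pdivlMr //; lra.
Qed.

(** Monotonicity of the subdifferential: in the sum of the subgradient inequalities at [x1] and [x2]
    the values of [psi] cancel. *)
Lemma prox_firmly_nonexpansive u1 u2 x1 x2 :
  prox eta psi u1 x1 -> prox eta psi u2 x2 ->
  dotv (x1 - x2) (x1 - x2) <= dotv (u1 - u2) (x1 - x2).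
Proof.
move=> min1 min2.
have := prox_subgradient x2 min1; have := prox_subgradient x1 min2.
rewrite -(fineK (prox_fin_num min1)) -(fineK (prox_fin_num min2)) !lee_fin.
rewrite /= !dotvZl => le1 le2.
have := lerD le1 le2.
rewrite -subr_ge0 => le3.
have : 0 <= eta^-1 * (dotv (u1 - x1) (x1 - x2) - dotv (u2 - x2) (x1 - x2)).
  apply: (le_trans le3); rewrite !dotvE le_eqVlt; apply/orP; left; apply/eqP.
  ring.
rewrite pmulr_rge0 ?invr_gt0 // !dotvE; lra.
Qed.

Lemma prox_nonexpansive u1 u2 x1 x2 :
  prox eta psi u1 x1 -> prox eta psi u2 x2 ->
  norm2 (x1 - x2) <= norm2 (u1 - u2).
Proof.
move=> min1 min2; have le1 := prox_firmly_nonexpansive min1 min2.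
have le2 := le_trans le1 (dotv_le_norm2 _ _).
move: le2; rewrite -norm2_sqr expr2.
have := norm2_ge0 (x1 - x2); rewrite le_eqVlt => /predU1P[<-|gt0].
  by rewrite norm2_ge0.
by rewrite ler_pM2r.
Qed.

Hypothesis psi_lsc : lower_semicontinuous psi.

(** The affine minorant bounds the proximal objective from below, a minimizing sequence is Cauchy,
    and lower semicontinuity makes its limit a minimizer. *)
Lemma prox_exists (c : R) (s : 'rV[R]_p) u :
  (forall z, ((c + dotv s z)%:E <= psi z)%E) -> exists x, prox eta psi u x.
Proof.
move=> minorant.
pose h z : R := eta * fine (psi z) + 2^-1 * norm2 (z - u) ^+ 2.
pose E := [set r | exists2 z, psi z \is a fin_num & r = h z].
(* Completing the square: the constant comes from [0 <= dotv (k + eta *: s) (k + eta *: s)] with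
   [k = z - u]. *)
have E_lb : lbound E (eta * (c + dotv s u) - 2^-1 * eta ^+ 2 * dotv s s).
  move=> _ [z z_fin ->]; have := minorant z; rewrite -(fineK z_fin) lee_fin.
  rewrite /h; move: (fine _) => r.
  have -> : dotv s z = dotv s u + dotv s (z - u) by rewrite -dotvDr addrC subrK.
  rewrite norm2_sqr; move: (z - u) => k.
  have := dotv_ge0 (k + eta *: s); rewrite !dotvE (dotvC k s) => sq le_r.
  by have := ler_wpM2l (ltW eta_gt0) le_r; nra.
have E_inf : has_inf E.
  split; last by exists (eta * (c + dotv s u) - 2^-1 * eta ^+ 2 * dotv s s).
  have [z z_fin] := psi_proper.2; exists (h z), z => //.
  by rewrite fin_numE psi_proper.1.
pose m := inf E.
have m_le z : psi z \is a fin_num -> m <= h z.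
  by move=> z_fin; apply: ge_inf; [exact: E_inf.2|exists z].
have /choice[zs zsP] : forall n : nat, exists z,
    psi z \is a fin_num /\ h z < m + n.+1%:R^-1.
  move=> n; have n_gt0 : 0 < (n.+1%:R^-1 : R) by rewrite invr_gt0.
  by have [_ [z z_fin ->] lt_m] := inf_adherent n_gt0 E_inf; exists z.
(* The midpoint of two almost minimizers has value at least [m], so strong
   convexity bounds their distance. *)
have zs_close i j :
    norm2 (zs i - zs j) ^+ 2 <= 4 * (i.+1%:R^-1 + j.+1%:R^-1).
  have [fi hi] := zsP i; have [fj hj] := zsP j.
  pose z := 2^-1 *: zs i + (1 - 2^-1) *: zs j.
  have half01 : 0 <= (2^-1 : R) <= 1 by lra.
  have := psi_convex (zs i) (zs j) half01; rewrite -/z.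
  rewrite -(fineK fi) -(fineK fj) -!EFinM -EFinD => cvx.
  have z_fin : psi z \is a fin_num.
    by rewrite fin_numE psi_proper.1 /=; apply: contraTneq cvx => ->.
  move: cvx; rewrite -(fineK z_fin) lee_fin => cvx.
  have := m_le z z_fin; move: hi hj; rewrite /h !norm2_sqr.
  have -> : z - u = 2^-1 *: (zs i - u) + (1 - 2^-1) *: (zs j - u).
    by apply/rowP => k; rewrite !mxE; ring.
  have -> : zs i - zs j = (zs i - u) - (zs j - u).
    by apply/rowP => k; rewrite !mxE; ring.
  move: (zs i - u) (zs j - u) => a b; rewrite !dotvE (dotvC b a).
  have := ler_wpM2l (ltW eta_gt0) cvx.
  by move: (i.+1%:R^-1) (j.+1%:R^-1) => ei ej; lra.
have zs_cauchy : cauchy (zs @ \oo).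
  apply/cauchy_ballP => e e_gt0.
  (* The 8 absorbs the factor 4 of [zs_close] and its two summands. *)
  have e8_gt0 : 0 < e ^+ 2 / 8 by rewrite divr_gt0 ?exprn_gt0.
  have [N _ small] := near_infty_natSinv_lt (PosNum e8_gt0).
  pose tail := [set zs i | i in [set i | (N <= i)%N]].
  have tailP : (zs @ \oo) tail by exists N => // i Ni; exists i.
  exists (tail, tail) => // -[_ _] [/= [i Ni <-] [j Nj <-]].
  split=> // i0 k; rewrite -ball_normE /= ord1.
  have := coord_le_norm2 (zs i - zs j) k; rewrite !mxE => /le_lt_trans; apply.
  rewrite -ltr_sqr ?nnegrE ?norm2_ge0 ?(ltW e_gt0) //.
  apply: (le_lt_trans (zs_close i j)).
  move: (small i Ni) (small j Nj) => /=.
  by move: (i.+1%:R^-1) (j.+1%:R^-1) => ei ej; lra.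
have zs_cvg : cvg (zs @ \oo) by exact/cauchy_cvgP.
pose l : 'rV[R]_p := lim (zs @ \oo).
have zs_l : zs @ \oo --> l := zs_cvg.
exists l.
have q_cvg : (2^-1 * norm2 (zs n - u) ^+ 2) @[n --> \oo] -->
    2^-1 * norm2 (l - u) ^+ 2.
  apply: cvgMl_tmp; apply: (cvg_comp zs (fun z => norm2 (z - u) ^+ 2) zs_l).
  exact: norm2_sqr_continuous.
set q := 2^-1 * norm2 (l - u) ^+ 2 in q_cvg.
have l_min : (eta%:E * psi l + q%:E <= m%:E)%E.
  rewrite leNgt; apply/negP => lt_m.
  (* If the limit were not minimal, some real [a] below [psi l] would still have [eta * a + q] above
     [m]: for finite [psi l] this value is the midpoint of [m] and the objective at [l], otherwise
     it is [m + 1]. Semicontinuity then puts [a] below [psi] along the tail of [zs]. *)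
  have [a lt_a a_lt] : exists2 a, m < eta * a + q & (a%:E < psi l)%E.
    move: lt_m (psi_proper.1 l); case: (psi l) => [r| |] // lt_m _.
      move: lt_m; rewrite -EFinM -EFinD lte_fin => lt_m.
      exists (r - (eta * r + q - m) / (2 * eta)).
        suff -> : eta * (r - (eta * r + q - m) / (2 * eta)) =
            eta * r - (eta * r + q - m) / 2 by lra.
        by field; rewrite gt_eqF.
      by rewrite lte_fin gtrBl divr_gt0 ?mulr_gt0 //; lra.
    exists ((m - q + 1) / eta); last exact: ltry.
    by rewrite (mulrC eta) divfK ?gt_eqF //; lra.
  have [V Vl Vpsi] := psi_lsc a_lt.
  have : eta * a + q <= m + 0.
    apply: (@ler_cvg_to _ \oo _ _
      (fun n => eta * a + 2^-1 * norm2 (zs n - u) ^+ 2)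
      (fun n => m + n.+1%:R^-1)).
    - by apply: cvgD => //; exact: cvg_cst.
    - by apply: cvgD; [exact: cvg_cst|exact: cvg_harmonic].
    - near=> n; have [z_fin /ltW] := zsP n.
      have : (a%:E < psi (zs n))%E by apply: Vpsi; near: n; exact: zs_l.
      rewrite -(fineK z_fin) lte_fin => /ltW le_a; apply: le_trans.
      by rewrite /h lerD2r ler_wpM2l // ltW.
  by rewrite addr0 leNgt lt_a.
move=> z; apply: (le_trans l_min).
have := psi_proper.1 z; case zE : (psi z) => [r| |] // _.
  by have := m_le z; rewrite /h zE => /(_ isT); rewrite -EFinM -EFinD lee_fin.
by rewrite gt0_muley ?lte_fin // addye // leey.
Unshelve. all: by end_near.
Qed.

(** The default 0 is returned only on an empty set, which [prox_nonempty] excludes. *)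
Definition prox_map u := xget 0 (prox eta psi u).

Hypothesis prox_nonempty : forall u, exists x, prox eta psi u x.

Lemma prox_mapP u : prox eta psi u (prox_map u).
Proof. exact: xgetPex (prox_nonempty u). Qed.

Lemma prox_mapE u x : prox eta psi u x -> x = prox_map u.
Proof.
move=> min_x; apply/eqP; rewrite -subr_eq0; apply/eqP/norm2_eq0/le_anti.
rewrite norm2_ge0 andbT (le_trans (prox_nonexpansive min_x (prox_mapP u))) //.
by rewrite subrr /norm2 dotv0l sqrtr0.
Qed.

Lemma prox_map_continuous : continuous prox_map.
Proof.
move=> u; apply/(@cvg_ballP _ _ _ (nbhs u)) => e e_gt0.
have e2_gt0 : 0 < e ^+ 2 by rewrite exprn_gt0.
have : (fun z => norm2 (z - u) ^+ 2) @ nbhs u --> norm2 (u - u) ^+ 2.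
  exact: norm2_sqr_continuous.
move=> /(@cvgrPdist_lt _ _ _ (nbhs u))/(_ _ e2_gt0); apply: filterS => z.
rewrite subrr {1}/norm2 dotv0l sqrtr0 expr0n sub0r normrN.
rewrite ger0_norm ?sqr_ge0 // => le_e; split=> // i0 i.
rewrite -ball_normE /= ord1.
have := coord_le_norm2 (prox_map u - prox_map z) i; rewrite !mxE.
move=> /le_lt_trans; apply.
apply: le_lt_trans (prox_nonexpansive (prox_mapP u) (prox_mapP z)) _.
rewrite -ltr_sqr ?nnegrE ?norm2_ge0 ?(ltW e_gt0) //.
by rewrite norm2_sqr -opprB dotvNl dotvNr opprK -norm2_sqr.
Qed.

End proximal_operator.

(** * Measurability of functions of random vectors, by way of grids *)

Section measurable_vectors.
Context {R : realType} {p : nat}.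

(* Two points have the same code when they lie in the same cube of the grid of
   mesh [1 / N.+1]. *)
Definition cell (N : nat) (z : 'rV[R]_p) : nat :=
  pickle [ffun i : 'I_p => Num.floor (N.+1%:R * z 0 i)].

Lemma cell_close N z z' i : cell N z = cell N z' ->
  `|z 0 i - z' 0 i| <= N.+1%:R^-1.
Proof.
move=> /(pcan_inj pickleK)/ffunP/(_ i); rewrite !ffunE.
have := floor_itv (N.+1%:R * z 0 i); have := floor_itv (N.+1%:R * z' 0 i).
rewrite !intrD => /andP[l1 u1] /andP[l2 u2] eq_floor.
rewrite -[leRHS]mul1r ler_pdivlMr ?ltr0n //.
rewrite -[X in _ * X]gtr0_norm ?ltr0n // -normrM mulrC mulrBr ler_norml.
by move: l1 u1 l2 u2; rewrite eq_floor; move: (Num.floor _)%:~R => a; lra.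
Qed.

Lemma open_cell (U : set 'rV[R]_p) z : open U -> U z ->
  exists N, forall z', cell N z' = cell N z -> U z'.
Proof.
move=> oU Uz; have [e /= e_gt0 ballU] := (nbhs_ballP _ _).1 (open_nbhs_nbhs (conj oU Uz)).
have [N _ small] := near_infty_natSinv_lt (PosNum e_gt0).
exists N => z' eq_cell; apply: ballU; split=> // i0 i.
rewrite -ball_normE /= ord1.
apply: le_lt_trans (small N (leqnn N)).
by apply: cell_close.
Qed.

Context d (T : measurableType d) (X : T -> 'rV[R]_p).
Hypothesis mX : forall i, measurable_fun [set: T] (fun w => X w 0 i).

Lemma measurable_cell N m : measurable [set w | cell N (X w) = m].
Proof.
(* If [m] decodes to nothing, or to some [j] whose code is not [m], the level set is empty.
   Otherwise it is a finite intersection of preimages of half-open intervals. *)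
case jE : (unpickle m : option {ffun 'I_p -> int}) => [j|]; last first.
  rewrite (_ : mkset _ = set0) // -subset0 => w /= cellE.
  by move: jE; rewrite -cellE pickleK.
have [<-|ne] := eqVneq (pickle j) m; last first.
  rewrite (_ : mkset _ = set0) // -subset0 => w /= cellE.
  by move: jE ne; rewrite -cellE pickleK => -[<-]; rewrite eqxx.
have -> : [set w | cell N (X w) = pickle j] = \bigcap_(i in [set: 'I_p])
    ((fun w => N.+1%:R * X w 0 i) @^-1` `[(j i)%:~R, (j i + 1)%:~R[%classic).
  apply/seteqP; split => w /=.
    move=> /(pcan_inj pickleK) jw i _ /=; rewrite in_itv /= -floor_eq.
    by rewrite -jw ffunE.
  move=> jw; congr pickle; apply/ffunP => i; rewrite ffunE; apply/eqP.
  by rewrite floor_eq; have := jw i I; rewrite /= in_itv.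
apply: fin_bigcap_measurable => // i _; rewrite -[X in measurable X]setTI.
apply: measurable_funM => //; exact: measurable_cst.
Qed.

(** Measurability is given coordinate by coordinate. It reaches open sets because each is the
    countable union, over all meshes, of the grid cells it contains. *)
Lemma measurable_preimage_open (U : set 'rV[R]_p) : open U ->
  measurable (X @^-1` U).
Proof.
move=> oU.
have -> : X @^-1` U = \bigcup_N \bigcup_(m in
    [set m | forall z, cell N z = m -> U z]) [set w | cell N (X w) = m].
  apply/seteqP; split=> w.
    by move=> /(open_cell oU)[N NU]; exists N => //; exists (cell N (X w)).
  by move=> [N _ [m mU] mw]; exact: mU mw.
by apply: bigcupT_measurable => N; apply: bigcup_measurable => m _; exact: measurable_cell.
Qed.

Lemma measurable_comp_continuous (h : 'rV[R]_p -> R) : continuous h ->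
  measurable_fun [set: T] (h \o X).
Proof.
move=> ch; apply: (measurability _ (RGenOInfty.measurableE R)).
move=> /= _ [_ [a ->]] <-; rewrite setTI comp_preimage.
by apply: measurable_preimage_open; apply: open_comp => //; exact: interval_open.
Qed.

(** Lower semicontinuity says that the sets [h > a] are open, and the rays above [a] generate the
    Borel sets of the extended line. *)
Lemma measurable_comp_lsc (h : 'rV[R]_p -> \bar R) : lower_semicontinuous h ->
  measurable_fun [set: T] (h \o X).
Proof.
move=> lh; apply: (measurability _ (ErealGenOInfty.measurableE R)).
move=> /= _ [_ [a ->]] <-; rewrite setTI comp_preimage.
apply: measurable_preimage_open.
by rewrite preimage_itvoy; move/lower_semicontinuousP : lh; exact.
Qed.

End measurable_vectors.

(** * Integrating an inequality with a conditionally centered linear term *)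

Section unbiased_noise.
Context d (T : measurableType d) {R : realType} {p : nat}.
Variables (mu : {measure set T -> \bar R}) (G : set (set T)).
Hypotheses (sG : sigma_algebra [set: T] G) (mG : G `<=` measurable).

Lemma sub_measurable_measurable (X : T -> R) : sub_measurable G X ->
  measurable_fun [set: T] X.
Proof.
move=> mX _ Y mY; apply: mG; rewrite -(sigma_algebra_id sG).
by apply: mX.
Qed.

Lemma le_integral_unbiased (n Z : T -> 'rV[R]_p) (V W : T -> \bar R) :
  (forall i, mu.-integrable [set: T] (fun w => (n w 0 i)%:E)) ->
  (forall i A, G A -> (\int[mu]_(w in A) (n w 0 i)%:E = 0)%E) ->
  (forall i, sub_measurable G (fun w => Z w 0 i)) ->
  measurable_fun [set: T] V -> measurable_fun [set: T] W ->
  (forall w, 0 <= V w)%E -> (forall w, 0 <= W w)%E ->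
  (forall w, V w <= W w + (dotv (n w) (Z w))%:E)%E ->
  (\int[mu]_w V w <= \int[mu]_w W w)%E.
Proof.
move=> in_ n0 mZ mV mW V0 W0 VW.
(* The l1 norm of the noise: moving each coordinate of [Z] by at most [r] changes [dotv (n w) (Z w)]
   by at most [r * S w]. *)
pose S w := \sum_(i < p) `|n w 0 i|.
have S0 w : 0 <= S w by apply: sumr_ge0.
have iS : mu.-integrable [set: T] (EFin \o S).
  rewrite (_ : _ \o _ = fun w => \sum_(i < p) `|(n w 0 i)%:E|%E).
    apply: integrable_sum => // i _; exact: integrable_abse (in_ i).
  by apply/funext => w /=; rewrite /S sumEFin.
have mS : measurable_fun [set: T] (EFin \o S) := measurable_int _ iS.
have intS_fin : (\int[mu]_w (S w)%:E)%E \is a fin_num by exact: integrable_fin_num.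
pose M := fine (\int[mu]_w (S w)%:E)%E.
have M_ge0 : 0 <= M by apply: fine_ge0; apply: integral_ge0 => w _; rewrite lee_fin.
(* [N] is chosen so that rounding [Z] to the grid costs at most [M / N.+1 <= e]. *)
apply/lee_addgt0Pr => e e_gt0.
have eM_gt0 : 0 < e / (M + 1) by rewrite divr_gt0 // ltr_wpDl.
have [N _ /(_ N (leqnn N)) /= small] := near_infty_natSinv_lt (PosNum eM_gt0).
set r : R := N.+1%:R^-1 in small.
have r_gt0 : 0 < r by rewrite invr_gt0.
pose U w := (W w + (r * S w)%:E)%E.
have mU : measurable_fun [set: T] U.
  apply: emeasurable_funD => //; under eq_fun do rewrite EFinM.
  apply: emeasurable_funM => //; exact: measurable_cst.
have U0 w : (0 <= U w)%E by rewrite adde_ge0 // lee_fin mulr_ge0 // ltW.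
pose A m := [set w | cell N (Z w) = m].
(* Measurability of the cells is taken over the sigma-algebra [G] itself, so that [n] integrates to
   0 on each of them. *)
have GA m : G (A m).
  rewrite -(sigma_algebra_id sG).
  exact: (@measurable_cell _ _ _ (g_sigma_algebraType G)).
have mA m : measurable (A m) by apply/mG.
have tA : trivIset setT A.
  apply/trivIsetP => i j _ _ ij; rewrite -subset0 => w [] /= iw jw.
  by move: ij; rewrite -iw -jw eqxx.
have cA : \bigcup_m A m = setT.
  by rewrite -subTset => w _; exists (cell N (Z w)).
have le_cell m : (\int[mu]_(w in A m) V w <= \int[mu]_(w in A m) U w)%E.
  have [->|/set0P[w0 Aw0]] := eqVneq (A m) set0; first by rewrite !integral_set0.
  (* An infinite right-hand side is trivial; otherwise [U] is integrable on the cell and [D] can be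
     added to it under the integral. *)
  have [Uoo|Ufin] := eqVneq (\int[mu]_(w in A m) U w)%E +oo%E.
    by rewrite Uoo leey.
  have mUA : measurable_fun (A m) U by exact: measurable_funTS.
  have mVA : measurable_fun (A m) V by exact: measurable_funTS.
  have iU : mu.-integrable (A m) U.
    apply/integrableP; split => //; under eq_integral do rewrite gee0_abs //.
    by rewrite ltey.
  have inA i : mu.-integrable (A m) (fun w => (n w 0 i)%:E).
    exact: integrableS (in_ i).
  (* The linear term with [Z] frozen at a point [w0] of the cell. *)
  pose D w := \sum_(i < p) ((Z w0 0 i)%:E * (n w 0 i)%:E)%E.
  have iD : mu.-integrable (A m) D.
    by apply: integrable_sum => // i _; exact: integrableZl.
  have intD : (\int[mu]_(w in A m) D w = 0)%E.
    rewrite integral_sum //; last by move=> i; exact: integrableZl.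
    by rewrite big1 // => i _; rewrite integralZl // n0 // mule0.
  rewrite -[leRHS]adde0 -intD -integralD //.
  apply: ge0_le_integral => //.
    by apply: emeasurable_funD => //; exact: measurable_int iD.
  move=> w Aw; apply: (le_trans (VW w)).
  rewrite /U -addeA leeD2l // /D.
  under eq_bigr do rewrite -EFinM.
  rewrite sumEFin -EFinD lee_fin -lerBlDr /dotv -sumrB /S mulr_sumr.
  apply: ler_sum => i _; rewrite (mulrC (n w 0 i)) -mulrBl.
  apply: (le_trans (ler_norm _)); rewrite normrM ler_wpM2r //.
  by apply: cell_close; rewrite Aw.
have -> : (\int[mu]_w V w)%E = (\sum_(0 <= m <oo) \int[mu]_(w in A m) V w)%E.
  by rewrite -cA ge0_integral_bigcup // cA.
apply: (@le_trans _ _ (\int[mu]_w U w)%E).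
  have -> : (\int[mu]_w U w)%E = (\sum_(0 <= m <oo) \int[mu]_(w in A m) U w)%E.
    by rewrite -cA ge0_integral_bigcup // cA.
  by apply: lee_nneseries => m *; [exact: integral_ge0|exact: le_cell].
rewrite ge0_integralD //; last first.
- under eq_fun do rewrite EFinM.
  apply: emeasurable_funM => //; exact: measurable_cst.
- by move=> w _; rewrite lee_fin mulr_ge0 // ltW.
rewrite leeD2l //; under eq_integral do rewrite EFinM.
rewrite ge0_integralZl //; first last.
- by rewrite lee_fin ltW.
- by move=> w _; rewrite lee_fin.
rewrite -(fineK intS_fin) -/M -EFinM lee_fin.
move: small; rewrite ltr_pdivlMr ?ltr_wpDl //.
by move=> /ltW; apply: le_trans; rewrite ler_wpM2l ?lerDl // ltW.
Qed.

Lemma is_cond_exp_unbiased (P : probability T R) (X Y : T -> R) :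
  is_cond_exp P G X Y ->
  P.-integrable [set: T] (fun w => (X w - Y w)%:E) /\
  forall A, G A -> (\int[P]_(w in A) (X w - Y w)%:E = 0)%E.
Proof.
move=> [iX iY _ XY]; split=> [|A GA].
  by apply: eq_integrable (integrableB _ iX iY) => // w _ /=; rewrite EFinB.
have mA := mG GA.
have iXA : P.-integrable A (EFin \o X) by exact: integrableS iX.
have iYA : P.-integrable A (EFin \o Y) by exact: integrableS iY.
under eq_integral do rewrite EFinB.
rewrite integralB // XY // subee //.
exact: integrable_fin_num.
Qed.

End unbiased_noise.

(** * The one-step energy inequality in centered coordinates *)

Section one_step.
Context {R : realType} {p : nat}.
Implicit Types (u v x y z n G : 'rV[R]_p).

(* Everything is expressed relative to [y]: [u = v_{k-1} - y], [e = xstar - y],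
   and [G] is the composite gradient step [(y - x_k) / eta]. *)
Lemma accelerated_step_centered (u e G n gr vk : 'rV[R]_p)
    (eta delta gamma gammak mu c fk fy psik Fp Fs : R) :
  0 < eta -> 0 < delta <= 1 -> 0 < gamma -> 0 < gammak -> 0 <= mu ->
  delta ^+ 2 = eta * gammak -> gammak = (1 - delta) * gamma + delta * mu ->
  c = gamma * delta / gammak ->
  fk <= fy + dotv gr (- eta *: G) + (2 * eta)^-1 * dotv (- eta *: G) (- eta *: G) ->
  (1 - delta) * (fy + dotv gr (- c *: u) + psik
                 + dotv (G - n - gr) (- c *: u + eta *: G)) <= (1 - delta) * Fp ->
  fy + dotv gr e + mu / 2 * dotv e e + psik + dotv (G - n - gr) (e + eta *: G)
    <= Fs ->
  vk = ((1 - delta) * gamma / gammak) *: u - (delta / gammak) *: G ->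
  fk + psik - Fs + gammak / 2 * dotv (vk - e) (vk - e) <=
  (1 - delta) * (Fp - Fs + gamma / 2 * dotv (u - e) (u - e))
  + dotv n ((1 - delta) *: (- c *: u) + delta *: e + eta *: G).
Proof.
move=> eta_gt0 /andP[delta_gt0 delta_le1] gamma_gt0 gammak_gt0 mu_ge0 dd gammakE.
move=> cE descent convex_prev convex_star ->.
(* Eliminating [eta] and [mu] in favour of [delta], [gamma] and [gammak] turns the last goal into an
   identity of rational functions. *)
have etaE : eta = delta ^+ 2 / gammak by rewrite dd mulfK ?gt_eqF.
have muE : mu = (gammak - (1 - delta) * gamma) / delta.
  by rewrite gammakE; field; rewrite gt_eqF.
(* The two sides differ exactly by [curv] plus the slacks of [descent], of [convex_prev] and of
   [delta] times [convex_star]. *)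
have curv : 0 <= (1 - delta) * gamma * (delta * mu) / (2 * gammak) * dotv u u.
  have d1_ge0 : 0 <= 1 - delta by lra.
  apply: mulr_ge0 (dotv_ge0 u).
  by rewrite divr_ge0 ?mulr_ge0 // ltW.
have star := ler_wpM2l (ltW delta_gt0) convex_star.
rewrite -subr_ge0 in descent; rewrite -subr_ge0 in convex_prev.
rewrite -subr_ge0 in star; rewrite -subr_ge0.
have slack := addr_ge0 curv (addr_ge0 descent (addr_ge0 convex_prev star)).
apply: le_trans slack _.
rewrite le_eqVlt; apply/orP; left; apply/eqP; rewrite !dotvE.
rewrite (dotvC G u) (dotvC e u) (dotvC e G).
rewrite muE cE etaE; field.
by rewrite !gt_eqF.
Qed.

End one_step.

(** * Quadratic surrogates, their centers and the extrapolation *)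

Section estimate_sequence_step.
Context {R : realType} {p : nat}.
Implicit Types (u v x y z n g : 'rV[R]_p).

Lemma quadratic_argmin (h : 'rV[R]_p -> R) (c gamma : R) v z : 0 < gamma ->
  (forall z, h z = c + gamma / 2 * norm2 (z - v) ^+ 2) -> argmin h z -> z = v.
Proof.
move=> gamma_gt0 hE /(_ v); rewrite -[(_ <= _)%O]/(h z <= h v) !hE.
rewrite subrr !norm2_sqr dotv0l mulr0 addr0 gerDl pmulr_rle0 ?divr_gt0 // => le0.
apply/eqP; rewrite -subr_eq0; apply/eqP/dotv_eq0/eqP.
by rewrite eq_le le0 dotv_ge0.
Qed.

Variables (eta delta gamma gammak mu c : R).
Hypotheses (eta_gt0 : 0 < eta) (delta_gt0 : 0 < delta) (gamma_gt0 : 0 < gamma).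
Hypotheses (gammak_gt0 : 0 < gammak).
Hypothesis delta_sqr : delta ^+ 2 = eta * gammak.
Hypothesis gammakE : gammak = (1 - delta) * gamma + delta * mu.
Hypothesis cE : c = gamma * delta / gammak.
Variables (xp y v xk vk : 'rV[R]_p).
Hypothesis yE : (1 + c) *: y = xp + c *: v.
(** First-order condition for the next surrogate; the stochastic gradient in the linear model
    cancels against the one in the subgradient of [psi]. *)
Hypothesis vkE : vk = gammak^-1 *:
  (((1 - delta) * gamma) *: v + (delta * mu) *: y - (delta / eta) *: (y - xk)).

Let etaE : eta = delta ^+ 2 / gammak.
Proof. by rewrite delta_sqr mulfK ?gt_eqF. Qed.

Let muE : mu = (gammak - (1 - delta) * gamma) / delta.
Proof. by rewrite gammakE; field; rewrite gt_eqF. Qed.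

Let centerE : vk - y = ((1 - delta) * gamma / gammak) *: (v - y)
  - (delta / gammak) *: (eta^-1 *: (y - xk)).
Proof.
rewrite vkE; apply/rowP => i; rewrite !mxE muE etaE; field.
by rewrite !gt_eqF.
Qed.

(** Holds because [model] is quadratic with curvature [gammak] and stationary point [vk]; [b0] and
    [b1] stand for the values of [f] at [y] and of [psi] at [xk]. *)
Lemma surrogate_step (g z : 'rV[R]_p) (c0 b0 b1 : R) :
  let model z := (1 - delta) * (c0 + gamma / 2 * norm2 (z - v) ^+ 2)
    + delta * (b0 + dotv g (z - y) + mu / 2 * norm2 (z - y) ^+ 2 + b1
               + dotv (eta^-1 *: (y - xk) - g) (z - xk)) in
  model z = model vk + gammak / 2 * norm2 (z - vk) ^+ 2.
Proof.
move=> model; rewrite /model !norm2_sqr.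
have -> : z - v = (z - y) - (v - y) by rewrite opprB addrA subrK.
have -> : vk - v = (vk - y) - (v - y) by rewrite opprB addrA subrK.
have -> : z - vk = (z - y) - (vk - y) by rewrite opprB addrA subrK.
have -> : z - xk = (z - y) + (y - xk) by rewrite addrA subrK.
have -> : vk - xk = (vk - y) + (y - xk) by rewrite addrA subrK.
rewrite centerE; move: (z - y) (v - y) (y - xk) => t u h.
rewrite !dotvE (dotvC t u) (dotvC h u) (dotvC t h) muE etaE; field.
by rewrite !gt_eqF.
Qed.

Lemma accelerated_step (gr n xs : 'rV[R]_p) (fk fy psik Fp Fs : R) :
  delta <= 1 -> 0 <= mu ->
  fk <= fy + dotv gr (xk - y) + (2 * eta)^-1 * norm2 (xk - y) ^+ 2 ->
  (1 - delta) * (fy + dotv gr (xp - y) + psik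
    + dotv (eta^-1 *: (y - xk) - (gr + n)) (xp - xk)) <= (1 - delta) * Fp ->
  fy + dotv gr (xs - y) + mu / 2 * norm2 (xs - y) ^+ 2
    + psik + dotv (eta^-1 *: (y - xk) - (gr + n)) (xs - xk) <= Fs ->
  fk + psik - Fs + gammak / 2 * norm2 (vk - xs) ^+ 2 <=
  (1 - delta) * (Fp - Fs + gamma / 2 * norm2 (v - xs) ^+ 2)
  + dotv n ((1 - delta) *: xp + delta *: xs - xk).
Proof.
move=> delta_le1 mu_ge0; set G := eta^-1 *: (y - xk).
have xkE : xk = y - eta *: G by rewrite scalerA divff ?gt_eqF // scale1r subKr.
have xkB : xk - y = - eta *: G by rewrite xkE addrC addKr scaleNr.
have xpB : xp - y = - c *: (v - y).
  have -> : xp = (1 + c) *: y - c *: v by rewrite yE addrK.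
  by apply/rowP => i; rewrite !mxE; ring.
have -> : xp - xk = - c *: (v - y) + eta *: G.
  by rewrite -xpB -[eta *: G]opprK -scaleNr -xkB opprB addrA subrK.
have -> : xs - xk = (xs - y) + eta *: G.
  by rewrite -[eta *: G]opprK -scaleNr -xkB opprB addrA subrK.
have -> : (1 - delta) *: xp + delta *: xs - xk =
    (1 - delta) *: (- c *: (v - y)) + delta *: (xs - y) + eta *: G.
  rewrite -xpB -[eta *: G]opprK -scaleNr -xkB.
  by apply/rowP => i; rewrite !mxE; ring.
have -> : vk - xs = (vk - y) - (xs - y) by rewrite opprB addrA subrK.
have -> : v - xs = (v - y) - (xs - y) by rewrite opprB addrA subrK.
rewrite xkB xpB !norm2_sqr.
have -> : G - (gr + n) = G - n - gr by rewrite opprD addrA addrAC.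
move=> descent convex_prev convex_star.
apply: (accelerated_step_centered eta_gt0 _ gamma_gt0 gammak_gt0 mu_ge0
  delta_sqr gammakE cE descent convex_prev convex_star centerE).
by rewrite delta_gt0.
Qed.

(** The coupling places [vk] at [xp + delta^-1 *: (xk - xp)], on the line through [xp] and [xk]. A
    momentum step along that line can therefore restore the coupling at the next index, and [beta]
    is its length. *)
Lemma extrapolation_step (eta' delta' gamma' : R) : 0 < delta' -> 0 < gamma' ->
  delta' ^+ 2 = eta' * gamma' ->
  let beta := delta * (1 - delta) * eta' / (eta * delta' + eta' * delta ^+ 2) in
  let c' := gammak * delta' / gamma' in
  (1 + c') *: (xk + beta *: (xk - xp)) = xk + c' *: vk.
Proof.
move=> d_gt0 g_gt0 dd beta c'.
have eta'E : eta' = delta' ^+ 2 / gamma' by rewrite dd mulfK ?gt_eqF.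
have -> : vk = xp + delta^-1 *: (xk - xp).
  have -> : xp = (1 + c) *: y - c *: v by rewrite yE addrK.
  rewrite vkE; apply/rowP => i; rewrite !mxE cE muE etaE; field.
  by rewrite !gt_eqF.
apply/rowP => i; rewrite !mxE /beta /c' eta'E etaE; field.
by rewrite !gt_eqF //= addr_gt0 ?mulr_gt0 ?exprn_gt0 ?mulr_gt0.
Qed.

End estimate_sequence_step.

(** * Bounds on the step-size parameters *)

Section step_sizes.
Context {R : realType}.
Variables (L mu : R) (eta delta gamma : nat -> R).
Hypotheses (L_gt0 : 0 < L) (mu_le_L : mu <= L).
Hypothesis eta_bounds : forall k, 0 < eta k <= 1 / L.
Hypotheses (gamma0_ge_mu : mu <= gamma 0%N) (gamma0_gt0 : 0 < gamma 0%N).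
Hypothesis deltaE : forall k, delta k = Num.sqrt (eta k * gamma k).
Hypothesis gammaE : forall k,
  gamma k.+1 = (1 - delta k.+1) * gamma k + delta k.+1 * mu.

Lemma eta_gt0 k : 0 < eta k.
Proof. by have /andP[] := eta_bounds k. Qed.

(** The recursion is implicit, since [delta k.+1] depends on [gamma k.+1]. If [gamma k.+1 <= 0], the
    square root is 0 and [gamma k.+1 = gamma k > 0]. If [delta k.+1 > 1], then
    [gamma k.+1 <= mu <= L] and [delta k.+1 ^+ 2 <= 1]. Both are absurd. *)
Lemma gamma_delta_bounds k : mu <= gamma k -> 0 < gamma k ->
  [/\ mu <= gamma k.+1, 0 < gamma k.+1 & delta k.+1 <= 1].
Proof.
move=> ge_mu gt0; have := gammaE k.
have /andP[] := eta_bounds k.+1; have := deltaE k.+1.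
move: (gamma k) (gamma k.+1) (delta k.+1) (eta k.+1) ge_mu gt0.
move=> g g' dl e ge_mu gt0 dlE e_gt0 e_le g'E.
have dl_ge0 : 0 <= dl by rewrite dlE sqrtr_ge0.
have g'_gt0 : 0 < g'.
  rewrite ltNge; apply/negP => g'_le0.
  have dl0 : dl = 0 by rewrite dlE ler0_sqrtr // pmulr_rle0.
  by move: g'_le0; rewrite g'E dl0; lra.
have dl2 : dl ^+ 2 = e * g' by rewrite dlE sqr_sqrtr // mulr_ge0 // ltW.
have dl_le1 : dl <= 1.
  rewrite leNgt; apply/negP => dl_gt1.
  have g'_le : g' <= L by apply: le_trans mu_le_L; rewrite g'E; nra.
  have : e * g' <= 1 / L * L by rewrite ler_pM // ltW.
  by rewrite -dl2 divfK ?gt_eqF //; nra.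
by split => //; rewrite g'E; nra.
Qed.

Lemma gamma_bounds k : mu <= gamma k /\ 0 < gamma k.
Proof. by elim: k => // k [ge_mu gt0]; have [] := gamma_delta_bounds ge_mu gt0. Qed.

Lemma gamma_gt0 k : 0 < gamma k. Proof. exact: (gamma_bounds k).2. Qed.

Lemma delta_gt0 k : 0 < delta k.
Proof. by rewrite deltaE sqrtr_gt0 mulr_gt0 ?eta_gt0 ?gamma_gt0. Qed.

(** Index 0 is left out: [gamma 0] can be large, so [delta 0] may exceed 1. *)
Lemma delta_le1 k : delta k.+1 <= 1.
Proof. by have [ge_mu gt0] := gamma_bounds k; have [] := gamma_delta_bounds ge_mu gt0. Qed.

Lemma delta_sqr k : delta k ^+ 2 = eta k * gamma k.
Proof. by rewrite deltaE sqr_sqrtr // ltW // mulr_gt0 ?eta_gt0 ?gamma_gt0. Qed.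

End step_sizes.

(** * The energy inequality along one trajectory *)

Section trajectory.
Context {R : realType} {p : nat}.
Variables (f : 'rV[R]_p -> R) (psi : 'rV[R]_p -> \bar R) (L mu : R).
Variables (xstar : 'rV[R]_p) (d0 : R) (eta delta gamma : nat -> R).
Hypotheses (L_gt0 : 0 < L) (mu_ge0 : 0 <= mu) (mu_le_L : mu <= L).
Hypotheses (f_smooth : smooth L f) (f_convex : strongly_convex mu f).
Hypotheses (psi_proper : proper psi) (psi_convex : convexe psi).
Hypothesis xstar_min : argmin (objective f psi) xstar.
Hypothesis eta_bounds : forall k, 0 < eta k <= 1 / L.
Hypotheses (gamma0_ge_mu : mu <= gamma 0%N) (gamma0_gt0 : 0 < gamma 0%N).
Hypothesis deltaE : forall k, delta k = Num.sqrt (eta k * gamma k).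
Hypothesis gammaE : forall k,
  gamma k.+1 = (1 - delta k.+1) * gamma k + delta k.+1 * mu.

Lemma psi_minimizer_fin_num : psi xstar \is a fin_num.
Proof.
rewrite fin_numE psi_proper.1 /=; apply/eqP => psioo.
have [z] := psi_proper.2; have := psi_proper.1 z.
have := xstar_min z; rewrite -[(_ <= _)%O]/(objective f psi xstar <= objective f psi z)%E.
by rewrite /objective psioo; case: (psi z).
Qed.

Lemma objective_gap_ge0 z : (0 <= objective f psi z - objective f psi xstar)%E.
Proof.
rewrite sube_ge0; first exact: xstar_min.
by rewrite /objective -(fineK psi_minimizer_fin_num).
Qed.

Definition energy (x v : 'rV[R]_p) (k : nat) : \bar R :=
  (objective f psi x - objective f psi xstar
   + (gamma k / 2 * norm2 (v - xstar) ^+ 2)%:E)%E.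

Lemma energy_ge0 x v k : (0 <= energy x v k)%E.
Proof.
rewrite adde_ge0 ?objective_gap_ge0 // lee_fin mulr_ge0 ?sqr_ge0 // divr_ge0 //.
by have [_ /ltW] := gamma_bounds L_gt0 mu_le_L eta_bounds gamma0_ge_mu gamma0_gt0
                      deltaE gammaE k.
Qed.

Variables (g x y v : nat -> 'rV[R]_p).
Hypothesis x_init : x 0%N = y 0%N.
Hypothesis x_step : forall k,
  prox (eta k.+1) psi (y k - eta k.+1 *: g k.+1) (x k.+1).
Hypothesis y_step : forall k,
  y k.+1 = x k.+1 + extrapolation eta delta k.+1 *: (x k.+1 - x k).
Hypothesis v_min : forall k,
  argmin (surrogate f psi mu eta delta d0 (gamma 0%N) g x y k) (v k).

Let e_gt0 := eta_gt0 eta_bounds.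
Let g_gt0 := gamma_gt0 L_gt0 mu_le_L eta_bounds gamma0_ge_mu gamma0_gt0
               deltaE gammaE.
Let d_gt0 := delta_gt0 L_gt0 mu_le_L eta_bounds gamma0_ge_mu gamma0_gt0
               deltaE gammaE.
Let d_le1 := delta_le1 L_gt0 mu_le_L eta_bounds gamma0_ge_mu gamma0_gt0
               deltaE gammaE.
Let d_sqr := delta_sqr L_gt0 mu_le_L eta_bounds gamma0_ge_mu gamma0_gt0
               deltaE gammaE.

Lemma surrogate_center_init : v 0%N = x 0%N.
Proof. by apply: quadratic_argmin gamma0_gt0 _ (v_min 0) => z. Qed.

Let center k := (gamma k.+1)^-1 *:
  (((1 - delta k.+1) * gamma k) *: v k + (delta k.+1 * mu) *: y k
   - (delta k.+1 / eta k.+1) *: (y k - x k.+1)).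

(** Since [v k] is only known as a minimizer, its closed form and this shape of the surrogate are
    obtained together by induction. *)
Let quadratic k := exists C, forall z,
  surrogate f psi mu eta delta d0 (gamma 0%N) g x y k z
  = C + gamma k / 2 * norm2 (z - v k) ^+ 2.

Lemma quadratic_step k : quadratic k -> v k.+1 = center k /\ quadratic k.+1.
Proof.
move=> [C quad].
have [C' quad'] : exists C', forall z,
    surrogate f psi mu eta delta d0 (gamma 0%N) g x y k.+1 z
    = C' + gamma k.+1 / 2 * norm2 (z - center k) ^+ 2.
  eexists => z; rewrite /= quad.
  exact: (surrogate_step (d_gt0 k.+1) (g_gt0 k.+1) (d_sqr k.+1) (gammaE k)
    (erefl (center k)) (g k.+1) z C (f (y k)) (fine (psi (x k.+1)))).
have vE := quadratic_argmin (g_gt0 k.+1) quad' (v_min k.+1).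
by split=> //; exists C' => z; rewrite quad' vE.
Qed.

Lemma surrogate_center_step k : v k.+1 = center k.
Proof.
suff quad : quadratic k by case: (quadratic_step quad).
elim: k => [|k /quadratic_step[_ quad //]].
by exists d0 => z; rewrite /= surrogate_center_init.
Qed.

Let coupling k := gamma k * delta k.+1 / gamma k.+1.

(** At index 0 the three points coincide; afterwards the extrapolation preserves the relation. *)
Lemma extrapolation_coupling k :
  (1 + coupling k) *: y k = x k + coupling k *: v k.
Proof.
elim: k => [|k IH].
  by rewrite surrogate_center_init -x_init scalerDl scale1r.
rewrite y_step.
exact: (extrapolation_step (d_gt0 k.+1) (g_gt0 k.+1) (d_sqr k.+1)
  (gammaE k) (erefl _) IH (surrogate_center_step k) (d_gt0 k.+2)
  (g_gt0 k.+2) (d_sqr k.+2)).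
Qed.

Lemma energy_step k w : let n := g k.+1 - grad f (y k) in
  prox (eta k.+1) psi (y k - eta k.+1 *: grad f (y k)) w ->
  (energy (x k.+1) (v k.+1) k.+1 <=
   (1 - delta k.+1)%:E * energy (x k) (v k) k
   + (eta k.+1 * norm2 n ^+ 2)%:E
   + (dotv n ((1 - delta k.+1) *: x k + delta k.+1 *: xstar - w))%:E)%E.
Proof.
move=> n w_min.
(* [psi] may be infinite at the arbitrary starting point; the right-hand side is then [+oo] unless
   [1 - delta k.+1] vanishes. *)
have [/andP[/eqP xk_oo d1]|xk_noo] :=
    boolP ((psi (x k) == +oo%E) && (delta k.+1 != 1)).
  rewrite {2}/energy /objective xk_oo -(fineK psi_minimizer_fin_num) -EFinD /=.
  rewrite gt0_muley ?lte_fin ?subr_gt0 ?lt_neqAle ?d1 ?d_le1 //.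
  by rewrite leey.
have xk_fin : delta k.+1 != 1 -> psi (x k) \is a fin_num.
  by move=> d1; move: xk_noo; rewrite d1 andbT fin_numE psi_proper.1.
(* From here on, if [psi (x k) = +oo] then [delta k.+1 = 1], and [Fp] is a junk
   value multiplied by 0. *)
set Fs := f xstar + fine (psi xstar).
set Fp := f (x k) + fine (psi (x k)).
have gE : g k.+1 = grad f (y k) + n by rewrite /n addrC subrK.
have xk1_fin := prox_fin_num (e_gt0 k.+1) psi_proper (x_step k).
have subg z := prox_subgradient (e_gt0 k.+1) psi_proper psi_convex z (x_step k).
have sE : (eta k.+1)^-1 *: (y k - eta k.+1 *: g k.+1 - x k.+1)
    = (eta k.+1)^-1 *: (y k - x k.+1) - (grad f (y k) + n).
  rewrite addrAC scalerBr scalerA mulVf ?gt_eqF // scale1r; congr (_ - _).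
  exact: gE.
have prev : (1 - delta k.+1) * (f (y k) + dotv (grad f (y k)) (x k - y k)
    + fine (psi (x k.+1))
    + dotv ((eta k.+1)^-1 *: (y k - x k.+1) - (grad f (y k) + n)) (x k - x k.+1))
    <= (1 - delta k.+1) * Fp.
  have [->|d1] := eqVneq (delta k.+1) 1; first by rewrite subrr !mul0r.
  rewrite ler_wpM2l ?subr_ge0 //.
  have := subg (x k); rewrite -{1}(fineK (xk_fin d1)) lee_fin sE.
  have := strongly_convex_lower_bound (x k) (f_smooth.1 (y k)) f_convex.
  have : 0 <= mu / 2 * norm2 (x k - y k) ^+ 2.
    by rewrite mulr_ge0 ?sqr_ge0 // divr_ge0.
  by rewrite /Fp; lra.
have star : f (y k) + dotv (grad f (y k)) (xstar - y k)
    + mu / 2 * norm2 (xstar - y k) ^+ 2 + fine (psi (x k.+1))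
    + dotv ((eta k.+1)^-1 *: (y k - x k.+1) - (grad f (y k) + n)) (xstar - x k.+1)
    <= Fs.
  have := subg xstar; rewrite -{1}(fineK psi_minimizer_fin_num) lee_fin sE.
  have := strongly_convex_lower_bound xstar (f_smooth.1 (y k)) f_convex.
  by rewrite /Fs; lra.
(* The bound [eta k.+1 <= 1 / L] replaces [L / 2] by [(2 * eta k.+1)^-1]. *)
have descent : f (x k.+1) <= f (y k) + dotv (grad f (y k)) (x k.+1 - y k)
    + (2 * eta k.+1)^-1 * norm2 (x k.+1 - y k) ^+ 2.
  apply: le_trans (smooth_upper_bound (y k) _ (ltW L_gt0) f_smooth) _.
  rewrite lerD2l ler_wpM2r ?sqr_ge0 // invfM mulrC ler_wpM2l // ?invr_ge0 //.
  have /andP[_ le_eta] := eta_bounds k.+1.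
  by rewrite -[L]invrK lef_pV2 ?posrE ?invr_gt0 // -div1r.
have step := accelerated_step (e_gt0 k.+1) (d_gt0 k.+1) (g_gt0 k) (g_gt0 k.+1) (d_sqr k.+1)
  (gammaE k) (erefl _) (extrapolation_coupling k) (surrogate_center_step k)
  (d_le1 k) mu_ge0 descent prev star.
(* With [h = w - x k.+1], firm nonexpansiveness gives [dotv h h <= eta k.+1 * dotv n h]; expanding
   the square of [h - eta k.+1 *: n] then bounds [dotv n h]. *)
have noise : dotv n (w - x k.+1) <= eta k.+1 * norm2 n ^+ 2.
  have := prox_firmly_nonexpansive (e_gt0 k.+1) psi_proper psi_convex w_min (x_step k).
  have -> : y k - eta k.+1 *: grad f (y k) - (y k - eta k.+1 *: g k.+1)
      = eta k.+1 *: n.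
    by apply/rowP => i; rewrite !mxE; ring.
  have := dotv_ge0 (w - x k.+1 - eta k.+1 *: n); rewrite norm2_sqr.
  clearbody n; move: (w - x k.+1) => h; rewrite !dotvE (dotvC h n) => sq le_h.
  by rewrite -(ler_pM2l (e_gt0 k.+1)); lra.
have splitE : dotv n ((1 - delta k.+1) *: x k + delta k.+1 *: xstar - x k.+1)
    = dotv n ((1 - delta k.+1) *: x k + delta k.+1 *: xstar - w)
      + dotv n (w - x k.+1).
  by rewrite -dotvDr addrA subrK.
have -> : ((1 - delta k.+1)%:E * energy (x k) (v k) k)%E
    = ((1 - delta k.+1) * (Fp - Fs + gamma k / 2 * norm2 (v k - xstar) ^+ 2))%:E.
  have [->|d1] := eqVneq (delta k.+1) 1; first by rewrite subrr mul0e mul0r.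
  rewrite /energy /objective -(fineK psi_minimizer_fin_num) -(fineK (xk_fin d1)).
  by rewrite -!EFinD -EFinM.
rewrite /energy /objective -(fineK xk1_fin) -(fineK psi_minimizer_fin_num).
rewrite -!EFinD lee_fin.
apply: le_trans step _; rewrite splitE; lra.
Qed.

End trajectory.

(** * From trajectories to expectations *)

Lemma sub_measurable_mono d (T : measurableType d) (R : realType) (G H : set (set T))
    (X : T -> R) : G `<=` H -> sub_measurable G X -> sub_measurable H X.
Proof.
by move=> GH mX mT Y mY; exact: (sub_sigma_algebra2 GH) _ (mX measurableT Y mY).
Qed.

Lemma prod_ratioS (R : realType) (delta : nat -> R) t k : (t <= k)%N ->
  prod_ratio delta t k.+1 = (1 - delta k.+1) * prod_ratio delta t k.
Proof. by move=> tk; rewrite /prod_ratio big_nat_recr //= mulrC. Qed.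

Theorem theorem12 (R : realType) (p : nat)
  (d : measure_display) (T : measurableType d) (P : probability T R)
  (f : 'rV[R]_p -> R) (psi : 'rV[R]_p -> \bar R) (L mu : R)
  (xstar x0 : 'rV[R]_p) (d0 : R)
  (eta delta gamma : nat -> R)
  (Fil : nat -> set (set T))
  (g x y v : nat -> T -> 'rV[R]_p)
  (L_gt0 : 0 < L) (mu_ge0 : 0 <= mu)
  (f_smooth : smooth L f) (f_convex : strongly_convex mu f)
  (psi_proper : proper psi) (psi_convex : convexe psi)
  (psi_lsc : lower_semicontinuous psi)
  (xstar_min : argmin (objective f psi) xstar)
  (eta_bounds : forall k, 0 < eta k <= 1 / L)
  (gamma0_ge_mu : mu <= gamma 0%N) (gamma0_gt0 : 0 < gamma 0%N)
  (deltaE : forall k, delta k = Num.sqrt (eta k * gamma k))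
  (gammaE : forall k,
     gamma k.+1 = (1 - delta k.+1) * gamma k + delta k.+1 * mu)
  (Fil_filtration : filtration Fil)
  (g_adapted : forall k i, sub_measurable (Fil k.+1) (fun w => g k.+1 w 0 i))
  (g_unbiased : forall k i,
     is_cond_exp P (Fil k) (fun w => g k.+1 w 0 i)
       (fun w => grad f (y k w) 0 i))
  (x_init : forall w, x 0%N w = x0) (y_init : forall w, y 0%N w = x0)
  (x_step : forall k w,
     prox (eta k.+1) psi (y k w - eta k.+1 *: g k.+1 w) (x k.+1 w))
  (y_step : forall k w,
     y k.+1 w = x k.+1 w
       + extrapolation eta delta k.+1 *: (x k.+1 w - x k w))
  (v_min : forall k w,
     argmin (surrogate f psi mu eta delta d0 (gamma 0%N)
               (g ^~ w) (x ^~ w) (y ^~ w) k) (v k w)) :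
  forall k, (1 <= k)%N ->
  (\int[P]_w (objective f psi (x k w) - objective f psi xstar
              + (gamma k / 2 * norm2 (v k w - xstar) ^+ 2)%:E)
   <= (Gamma delta k)%:E
        * (objective f psi x0 - objective f psi xstar
           + (gamma 0%N / 2 * norm2 (x0 - xstar) ^+ 2)%:E)
      + \sum_(1 <= t < k.+1)
          (prod_ratio delta t k * eta t)%:E
          * 'E_P[(fun w => norm2 (grad f (y t.-1 w) - g t w) ^+ 2)%R])%E.
Proof.
move=> k _.
(* [mu <= L] may fail in dimension 0, where both sides vanish. *)
have [p0|p_gt0] := posnP p.
  move: f psi xstar x0 g x y v f_smooth f_convex psi_proper psi_convex psi_lsc
    xstar_min g_adapted g_unbiased x_init y_init x_step y_step v_min.
  rewrite p0 => f' psi' xs z0 g' x' y' v' _ _ pr _ _ xs_min *.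
  have gap (a b : 'rV[R]_0) : (objective f' psi' a - objective f' psi' xs)%E = 0%E.
    rewrite (thinmx0 a) (thinmx0 xs) subee //.
    have := psi_minimizer_fin_num pr xs_min; rewrite (thinmx0 xs).
    by rewrite /objective; case: (psi' 0).
  have n0 (a : 'rV[R]_0) : norm2 a ^+ 2 = 0.
    by rewrite norm2_sqr /dotv big_ord0.
  rewrite gap // n0 mulr0 adde0 mule0 add0e.
  under eq_integral do rewrite gap // n0 mulr0 adde0.
  rewrite integral0; apply: sume_ge0 => t _.
  under [X in expectation _ X]eq_fun do rewrite n0.
  by rewrite expectation_cst mule0.
have mu_le_L := strong_convexity_le_smoothness p_gt0 (ltW L_gt0) f_smooth f_convex.
have [sFil Fil_meas Fil_mono] := Fil_filtration.
have e_gt0 := eta_gt0 eta_bounds.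
have d_le1 := delta_le1 L_gt0 mu_le_L eta_bounds gamma0_ge_mu gamma0_gt0
               deltaE gammaE.
(* A space of mass 1 is nonempty; the trajectory of [w0] supplies an affine minorant of [psi] and
   the constant initial energy. *)
have [w0 _] : exists w0 : T, True.
  have /set0P[w0 _] : [set: T] != set0.
    apply/eqP => T0; have := probability_setT P.
    by rewrite T0 measure0 => /eqP; rewrite eq_sym onee_eq0.
  by exists w0.
have prox_nonempty k' u : exists z, prox (eta k'.+1) psi u z.
  (* [x_step] yields proximal points only at arguments met by the algorithm. The subgradient [s] of
     [psi] at [x 1 w0] gives the minorant that provides them everywhere. *)
  pose s := (eta 1)^-1 *: (y 0%N w0 - eta 1 *: g 1%N w0 - x 1%N w0).
  apply: (prox_exists (e_gt0 k'.+1) psi_proper psi_convex psi_lsc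
    (c := fine (psi (x 1%N w0)) - dotv s (x 1%N w0)) (s := s)) => z.
  have := prox_subgradient (e_gt0 1) psi_proper psi_convex z (x_step 0 w0).
  by rewrite -/s; congr (_%:E <= _)%E; rewrite !dotvE; ring.
pose Pr k' := prox_map psi (eta k'.+1).
have Pr_min k' u : prox (eta k'.+1) psi u (Pr k' u) by exact: prox_mapP.
have Pr_cont k' i : continuous (fun u => Pr k' u 0 i).
  move=> u; apply: (cvg_comp (Pr k') (fun z : 'rV[R]_p => z 0 i)).
    exact: prox_map_continuous.
  exact: coord_continuous.
have xE k' w : x k'.+1 w = Pr k' (y k' w - eta k'.+1 *: g k'.+1 w).
  exact: prox_mapE.
have vE k' w := surrogate_center_step L_gt0 mu_le_L eta_bounds gamma0_ge_mu
  gamma0_gt0 deltaE gammaE (v_min ^~ w) k'.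
have v0E w := surrogate_center_init gamma0_gt0 (v_min ^~ w).
have m_lin G (a b : R) (X Y : T -> 'rV[R]_p) :
    (forall i, sub_measurable G (fun w => X w 0 i)) ->
    (forall i, sub_measurable G (fun w => Y w 0 i)) ->
    forall i, sub_measurable G (fun w => (a *: X w + b *: Y w) 0 i).
  move=> mX mY i.
  have -> : (fun w => (a *: X w + b *: Y w) 0 i)
      = (fun w => a * X w 0 i + b * Y w 0 i) by apply/funext => w; rewrite !mxE.
  exact: measurable_funD (measurable_funM (measurable_cst a) (mX i))
                         (measurable_funM (measurable_cst b) (mY i)).
have m_cst G (z : 'rV[R]_p) i : sub_measurable G (fun _ : T => z 0 i).
  exact: measurable_cst.
have adapted k' : [/\ forall i, sub_measurable (Fil k') (fun w => x k' w 0 i),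
    forall i, sub_measurable (Fil k') (fun w => y k' w 0 i) &
    forall i, sub_measurable (Fil k') (fun w => v k' w 0 i)].
  elim: k' => [|k' [mx my mv]].
    split=> i; rewrite (_ : (fun w => _) = fun=> x0 0 i); try exact: m_cst;
      by apply/funext => w; rewrite ?v0E ?x_init ?y_init.
  have up (X : T -> 'rV[R]_p) : (forall i, sub_measurable (Fil k') (fun w => X w 0 i)) ->
      forall i, sub_measurable (Fil k'.+1) (fun w => X w 0 i).
    by move=> mX i; exact: sub_measurable_mono (Fil_mono k') (mX i).
  have mx1 i : sub_measurable (Fil k'.+1) (fun w => x k'.+1 w 0 i).
    under eq_fun do rewrite xE -[y _ _]scale1r -scaleNr.
    apply: (@measurable_comp_continuous _ _ _ (g_sigma_algebraType (Fil k'.+1))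
      (fun w => 1 *: y k' w + - eta k'.+1 *: g k'.+1 w) _
      (fun u => Pr k' u 0 i)) => //.
    by apply: (m_lin) => //; exact: up.
  split => //.
    pose b := extrapolation eta delta k'.+1.
    have yE w : y k'.+1 w = (1 + b) *: x k'.+1 w + - b *: x k' w.
      by rewrite y_step -/b; apply/rowP => i; rewrite !mxE; ring.
    by move=> i; under eq_fun do rewrite yE; apply: (m_lin) => //; exact: up.
  pose a := (gamma k'.+1)^-1.
  pose b := delta k'.+1 / eta k'.+1.
  have vE' w : v k'.+1 w = (a * ((1 - delta k'.+1) * gamma k')) *: v k' w
      + a *: ((delta k'.+1 * mu - b) *: y k' w + b *: x k'.+1 w).
    by rewrite vE -/a -/b; apply/rowP => i; rewrite !mxE; ring.
  move=> i; under eq_fun do rewrite vE'.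
  by apply: (m_lin); [exact: up | apply: (m_lin) => //; exact: up].
pose V k' w := energy f psi xstar gamma (x k' w) (v k' w) k'.
have V_ge0 k' w : (0 <= V k' w)%E.
  exact: (energy_ge0 L_gt0 mu_le_L psi_proper xstar_min eta_bounds gamma0_ge_mu
            gamma0_gt0 deltaE gammaE).
have m_of k' (X : T -> 'rV[R]_p) : (forall i, sub_measurable (Fil k') (fun w => X w 0 i)) ->
    forall i, measurable_fun [set: T] (fun w => X w 0 i).
  by move=> mX i; exact (@sub_measurable_measurable _ _ _ _ (sFil k') (Fil_meas k') _ (mX i)).
have cont_f : continuous f.
  by move=> z; apply: differentiable_continuous; exact: f_smooth.1.
have mV k' : measurable_fun [set: T] (V k').
  have [/m_of mx _ /m_of mv] := adapted k'.
  apply: emeasurable_funD.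
    apply: emeasurable_funD; last exact: measurable_cst.
    apply: emeasurable_funD; last exact: measurable_comp_lsc.
    by apply/measurable_EFinP; exact: measurable_comp_continuous.
  apply/measurable_EFinP; have mv2 := measurable_comp_continuous mv (@norm2_sqr_continuous _ _ xstar).
  exact: measurable_funM (measurable_cst (gamma k' / 2)) mv2.
pose n k' w := g k'.+1 w - grad f (y k' w).
pose noise k' := (\int[P]_w (norm2 (n k' w) ^+ 2)%:E)%E.
(* All integrands are nonnegative, so the inequality is read in the extended reals and [noise k']
   may be infinite. *)
have recursion k' : (\int[P]_w V k'.+1 w <=
    (1 - delta k'.+1)%:E * \int[P]_w V k' w + (eta k'.+1)%:E * noise k')%E.
  have d1_ge0 : (0 <= (1 - delta k'.+1)%:E)%E by rewrite lee_fin subr_ge0.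
  have unb i := is_cond_exp_unbiased (Fil_meas k') (g_unbiased k' i).
  have nE w i : n k' w 0 i = g k'.+1 w 0 i - grad f (y k' w) 0 i by rewrite !mxE.
  have mn i : measurable_fun [set: T] (fun w => n k' w 0 i).
    under eq_fun do rewrite nE.
    by apply/measurable_EFinP; exact: measurable_int (unb i).1.
  have mn2 : measurable_fun [set: T] (fun w => (norm2 (n k' w) ^+ 2)%:E).
    apply/measurable_EFinP; under eq_fun do rewrite -[n _ _]subr0.
    exact (measurable_comp_continuous mn (@norm2_sqr_continuous _ _ 0)).
  have n2_ge0 w : (0 <= (norm2 (n k' w) ^+ 2)%:E)%E by rewrite lee_fin sqr_ge0.
  have e_ge0 : (0 <= (eta k'.+1)%:E)%E by rewrite lee_fin ltW.
  rewrite /noise -!ge0_integralZl //.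
  rewrite -ge0_integralD //; first last.
  - by apply: emeasurable_funM => //; exact: measurable_cst.
  - by move=> w _; exact: mule_ge0.
  - by apply: emeasurable_funM => //; exact: measurable_cst.
  - by move=> w _; exact: mule_ge0.
  (* The noiseless proximal point depends on [y k'] alone, so [Z] is known at time [k']; the factors
     1 and -1 give it the shape required by [m_lin]. *)
  pose Z w := (1 - delta k'.+1) *: x k' w
    + 1 *: (delta k'.+1 *: xstar + - 1 *: Pr k' (y k' w - eta k'.+1 *: grad f (y k' w))).
  apply: (@le_integral_unbiased _ _ _ _ P (Fil k') (sFil k') (Fil_meas k') (n k') Z) => //.
  - move=> i; under eq_fun do rewrite nE; exact: (unb i).1.
  - move=> i A FA; under eq_integral do rewrite nE; exact: (unb i).2.
  - have [mx my _] := adapted k'.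
    apply: (m_lin) => //; apply: (m_lin) => // i.
    under eq_fun do rewrite -[y _ _]scale1r -scaleNr.
    apply: (@measurable_comp_continuous _ _ _ (g_sigma_algebraType (Fil k'))
      (fun w => 1 *: y k' w + - eta k'.+1 *: grad f (1 *: y k' w)) _
      (fun u => Pr k' u 0 i)) => //.
    (* The gradient at [y k'] is measurable as a version of the conditional expectation of
       [g k'.+1]. *)
    apply: (m_lin) => // j; under eq_fun do rewrite scale1r.
    by have [] := g_unbiased k' j.
  - by apply: emeasurable_funD; apply: emeasurable_funM => //; exact: measurable_cst.
  - by move=> w; rewrite adde_ge0 ?mule_ge0.
  - move=> w; have x0y0 : x 0%N w = y 0%N w by rewrite x_init y_init.
    have := energy_step L_gt0 mu_ge0 mu_le_L f_smooth f_convex psi_proper psi_convex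
      xstar_min eta_bounds gamma0_ge_mu gamma0_gt0 deltaE gammaE x0y0 (x_step ^~ w)
      (y_step ^~ w) (v_min ^~ w) (Pr_min k' _).
    by rewrite /Z scale1r scaleN1r addrA EFinM.
have start : (\int[P]_w V 0%N w = V 0%N w0)%E.
  have -> : V 0%N = cst (V 0%N w0).
    by apply/funext => w; rewrite /V /= !v0E !x_init.
  by rewrite integral_cst //= probability_setT mule1.
(* The product starts at index 1, where [delta] is at most 1. *)
have Gamma_ge0 k' : 0 <= Gamma delta k'.
  rewrite /Gamma big_nat_cond; apply: prodr_ge0 => -[|i] //= _.
  by rewrite subr_ge0.
have bound k' : (\int[P]_w V k' w <= (Gamma delta k')%:E * V 0%N w0
    + \sum_(1 <= t < k'.+1) (prod_ratio delta t k' * eta t)%:E * noise t.-1)%E.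
  elim: k' => [|k' IH].
    by rewrite start big_geq // adde0 /Gamma big_geq // mul1e.
  apply: (le_trans (recursion k')).
  (* The new noise term enters with an empty product; all earlier terms gain the factor
     [1 - delta k'.+1]. *)
  have last_ratio : prod_ratio delta k'.+1 k'.+1 = 1 by rewrite /prod_ratio big_geq.
  rewrite big_nat_recr //= last_ratio mul1r addeA.
  rewrite leeD2r //; apply: (le_trans (lee_wpmul2l _ IH)); first by rewrite lee_fin subr_ge0.
  have noise_ge0 t : (0 <= noise t)%E by apply: integral_ge0 => w _; rewrite lee_fin sqr_ge0.
  have term_ge0 t : (0 <= (prod_ratio delta t k' * eta t)%:E * noise t.-1)%E.
    rewrite mule_ge0 // lee_fin mulr_ge0 //; last by have /andP[/ltW] := eta_bounds t.
    rewrite /prod_ratio big_nat_cond; apply: prodr_ge0 => -[|i] //= _.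
    by rewrite subr_ge0.
  rewrite ge0_muleDr ?mule_ge0 ?lee_fin ?sume_ge0 // ge0_sume_distrr //.
  have -> : Gamma delta k'.+1 = (1 - delta k'.+1) * Gamma delta k'.
    by rewrite /Gamma big_nat_recr //= mulrC.
  rewrite EFinM -muleA leeD2l //.
  rewrite le_eqVlt; apply/orP; left; apply/eqP; apply: eq_big_nat => t /andP[_ tk].
  by rewrite prod_ratioS // -mulrA [in RHS]EFinM -muleA.
have noiseE t : (1 <= t)%N ->
    ('E_P[(fun w => norm2 (grad f (y t.-1 w) - g t w) ^+ 2)%R] = noise t.-1)%E.
  case: t => // t _; rewrite unlock; apply: eq_integral => w _ /=.
  by rewrite /n !norm2_sqr -opprB dotvNl dotvNr opprK.
move: (bound k); rewrite /V /energy !v0E x_init => /le_trans; apply.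
rewrite leeD2l // le_eqVlt; apply/orP; left; apply/eqP.
by apply: eq_big_nat => t /andP[t1 _]; rewrite noiseE.
Qed.
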